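(* Let $n\ge 1$ and let $\mathfrak{S}_n$ be the set of permutations of $[n]=\{1,\dots,n\}$. The two set-valued statistics $$(\mathrm{Cyc},\ \mathrm{Arec}^{p},\ \mathrm{Exc}^{p},\ \mathrm{Exc}^{l},\ \mathrm{Rar})\quad\text{and}\quad(\mathrm{Arec}^{p},\ \mathrm{Cyc},\ \mathrm{Exc}^{p},\ \mathrm{Exc}^{l},\ \mathrm{Rar})$$ are equidistributed on $\mathfrak{S}_n$; that is, for all subsets $A,B,D,E,F\subseteq[n]$, $$\#\{\sigma\in\mathfrak{S}_n:\ (\mathrm{Cyc}\,\sigma,\mathrm{Arec}^{p}\sigma,\mathrm{Exc}^{p}\sigma,\mathrm{Exc}^{l}\sigma,\mathrm{Rar}\,\sigma)=(A,B,D,E,F)\}$$ $$=\#\{\sigma\in\mathfrak{S}_n:\ (\mathrm{Arec}^{p}\sigma,\mathrm{Cyc}\,\sigma,\mathrm{Exc}^{p}\sigma,\mathrm{Exc}^{l}\sigma,\mathrm{Rar}\,\sigma)=(A,B,D,E,F)\}.$$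
   Context: For $\sigma\in\mathfrak{S}_n$ and $i\in[n]$, the pair $(i,\sigma(i))$ is called: a record if $\sigma(j)<\sigma(i)$ for all $j<i$; an antirecord if $\sigma(j)>\sigma(i)$ for all $j>i$; a record-antirecord if it is both a record and an antirecord; an excedance if $\sigma(i)>i$. Define: $\mathrm{Arec}^{p}\sigma=\{i:(i,\sigma(i))\text{ is an antirecord}\}$; $\mathrm{Exc}^{p}\sigma=\{i:\sigma(i)>i\}$ and $\mathrm{Exc}^{l}\sigma=\{\sigma(i):\sigma(i)>i\}$; $\mathrm{Rar}\,\sigma=\{i:(i,\sigma(i))\text{ is a record-antirecord}\}$. Finally $\mathrm{Cyc}\,\sigma$ is the set of maximum elements of the cycles in the disjoint cycle decomposition of $\sigma$ (fixed points included as cycles of length one). *)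

(* Defs.v *)
From mathcomp Require Import all_boot all_fingroup.

Set Implicit Arguments.
Unset Strict Implicit.
Unset Printing Implicit Defensive.

(* Permutations of {1, ..., n} are rendered as permutations 'S_n of
   'I_n = {0, ..., n-1}; the order-preserving shift by one is immaterial, since
   all the notions below only refer to the order of the indices.  In all
   inequalities, elements of 'I_n are compared through their coercion to nat. *)

(* "record s i" says that the pair (i, s i) is a record, and similarly for the
   three predicates that follow. *)
Definition record n (s : 'S_n) (i : 'I_n) : bool :=
  [forall j : 'I_n, (j < i) ==> (s j < s i)].

Definition antirecord n (s : 'S_n) (i : 'I_n) : bool :=
  [forall j : 'I_n, (i < j) ==> (s i < s j)].

Definition record_antirecord n (s : 'S_n) (i : 'I_n) : bool :=
  record s i && antirecord s i.

Definition excedance n (s : 'S_n) (i : 'I_n) : bool := i < s i.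

Definition Arecp n (s : 'S_n) : {set 'I_n} := [set i | antirecord s i].

Definition Excp n (s : 'S_n) : {set 'I_n} := [set i | excedance s i].

Definition Excl n (s : 'S_n) : {set 'I_n} :=
  [set s i | i in 'I_n & excedance s i].

Definition Rar n (s : 'S_n) : {set 'I_n} := [set i | record_antirecord s i].

(* porbits s is the set of the supports of all the cycles of s, including the
   singletons of the fixed points. *)
Definition Cyc n (s : 'S_n) : {set 'I_n} :=
  [set i | [exists C in porbits s, (i \in C) && [forall j in C, j <= i]]].

(* Main.v *)
Require Import Defs.
From mathcomp Require Import all_boot all_fingroup cyclic.

(** Fix Exc^p = D and Exc^l = E; this determines Rar, since i is a
    record-antirecord iff i is not in D and no excedance crosses i.  Build s by
    scanning t = 1, ..., n and revealing the pairs (i, s i) with both entries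
    at most t.  What is revealed before t is a set of closed cycles and open
    paths, the number k of open paths depending only on D, E and t.  At t one
    chooses the preimage of t among the k ends of paths if t is in E, and the
    image of t among the available beginnings of paths if t is not in D.  For t
    outside D, t is a cycle maximum iff the choice closes a cycle, and an
    antirecord iff the image is the least available one.  The numbers of
    choices with prescribed answers to these two questions depend only on k and
    are symmetric in the two answers, so the symmetry follows by downward
    induction on t. *)

Set Implicit Arguments.
Unset Strict Implicit.
Unset Printing Implicit Defensive.

(** * Counting choices with two prescribed yes-or-no answers *)

(** Choose [q] first: the second answer concerns [q] alone, and for every [q] exactly one [p] in [P]
    equals [f q], so the two counts multiply. *)
Lemma card_pairs_graph_point (T : finType) (P Q : {set T}) (f : T -> T) y a b :
    {in Q, forall q, f q \in P} -> y \in Q ->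
  #|[set c in setX P Q | ((c.1 == f c.2) == a) && ((c.2 == y) == b)]| =
  (if a then 1 else #|P|.-1) * (if b then 1 else #|Q|.-1).
Proof.
have point (S : {set T}) (z : T) d : z \in S ->
    \sum_(q in S | (q == z) == d) 1 = if d then 1 else #|S|.-1.
  move=> zS; rewrite sum1dep_card; case: d.
    rewrite (_ : [set _ | _] = [set z]) ?cards1 //; apply/setP=> q.
    by rewrite !inE eqb_id; case: eqP => [->|]; rewrite ?zS ?andbF.
  rewrite (cardsD1 z S) zS /=; apply: eq_card => q.
  by rewrite !inE eqbF_neg andbC.
move=> fP yQ; rewrite -sum1dep_card.
rewrite (eq_bigl (fun c => ((c.2 \in Q) && ((c.2 == y) == b)) &&
                           ((c.1 \in P) && ((c.1 == f c.2) == a)))); last first.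
  case=> p q; rewrite !inE /=.
  by case: (p \in P); case: (q \in Q); rewrite ?andbF //= andbC.
rewrite (reindex_onto (fun c => (c.2, c.1)) (fun c => (c.2, c.1))) /=; last by case.
rewrite (eq_bigl (fun c : T * T => ((c.1 \in Q) && ((c.1 == y) == b)) &&
                           ((c.2 \in P) && ((c.2 == f c.1) == a)))); last first.
  by case=> p q /=; rewrite eqxx andbT.
rewrite -(pair_big_dep (fun q => (q \in Q) && ((q == y) == b))
                       (fun q p => (p \in P) && ((p == f q) == a)) (fun _ _ => 1)) /=.
under eq_bigr => q /andP[qQ _] do rewrite point ?fP //.
by rewrite sum_nat_cond_const -sum1dep_card point // mulnC.
Qed.

(** What matters is that the value is symmetric in [a] and [b]. When both answers are negative, one
    removes from [Q] the one or two points of the pair [x], [y]. *)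
Lemma card_two_points (T : finType) (Q : {set T}) (x y : T) (a b : bool) :
    x \in Q -> y \in Q ->
  #|[set q in Q | ((q == x) == a) && ((q == y) == b)]| =
  if a == b then (if a then (x == y) : nat else #|Q| - (x != y).+1)
  else (x != y) : nat.
Proof.
move=> xQ yQ; case: a b => -[] /=.
- have [<-|neq] := eqVneq x y.
    rewrite (_ : [set _ in _ | _] = [set x]) ?cards1 //; apply/setP=> q.
    by rewrite !inE !eqb_id andbb; case: eqP => [->|]; rewrite ?xQ ?andbF.
  apply/eqP; rewrite cards_eq0; apply/eqP/setP=> q; rewrite !inE !eqb_id.
  by case: eqP => [->|]; rewrite ?(negPf neq) ?andbF.
- have [<-|neq] := eqVneq x y.
    apply/eqP; rewrite cards_eq0; apply/eqP/setP=> q; rewrite !inE.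
    by case: (q == x); rewrite ?andbF.
  rewrite (_ : [set _ in _ | _] = [set x]) ?cards1 //; apply/setP=> q.
  by rewrite !inE !eqb_id eqbF_neg; case: eqP => [->|]; rewrite ?xQ ?neq ?andbF.
- have [<-|neq] := eqVneq x y.
    apply/eqP; rewrite cards_eq0; apply/eqP/setP=> q; rewrite !inE.
    by case: (q == x); rewrite ?andbF.
  rewrite (_ : [set _ in _ | _] = [set y]) ?cards1 //; apply/setP=> q.
  rewrite !inE !eqb_id eqbF_neg; case: (q =P y) => [->|]; rewrite ?andbF //.
  by rewrite yQ eq_sym neq.
rewrite (cardsD1 x Q) xQ (cardsD1 y (Q :\ x)) !inE yQ andbT eq_sym.
have -> : (true : nat) + ((x != y) + #|Q :\ x :\ y|)
        = (x != y).+1 + #|Q :\ x :\ y| by [].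
rewrite addKn; apply: eq_card => q.
by rewrite !inE; case: (q \in Q); case: (q == x); case: (q == y).
Qed.

Lemma quintuple_eqE (T : eqType) (a b c d e a' b' c' d' e' : T) :
  ((a, b, c, d, e) == (a', b', c', d', e')) =
  [&& a == a', b == b', c == c', d == d' & e == e'].
Proof. by rewrite !xpair_eqE -!andbA. Qed.

Section Prefix.

Variable n : nat.
Implicit Types (m : nat) (s u w : 'S_n) (i j p q t x y : 'I_n).

(** * Permutations sharing their excedance data and a revealed prefix *)

Definition exc_equiv s u := (Excp s == Excp u) && (Excl s == Excl u).

(** The disjunction makes a pair with both entries below [m] that occurs in either permutation occur
    in the other; images that are at least [m] in both may differ. *)
Definition prefix_equiv (m : nat) s u :=
  exc_equiv s u &&
  [forall i : 'I_n, (i < m) ==> (s i < m) || (u i < m) ==> (s i == u i)].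

(** The revealed pairs link the indices below [m] into closed cycles and open paths; an isolated
    index is a path, both its own beginning and its own end. *)
Definition open_ends (m : nat) s := [set i : 'I_n | (i < m) && (m <= s i)].
Definition open_begs (m : nat) s := [set j : 'I_n | (j < m) && (m <= s^-1%g j)].

Lemma mem_Excp s i : (i \in Excp s) = (i < s i).
Proof. by rewrite inE. Qed.

Lemma mem_Excl s j : (j \in Excl s) = (s^-1%g j < j).
Proof.
apply/imsetP/idP => [[i]|lt_j]; first by rewrite inE => /andP[_ ?] ->; rewrite permK.
by exists (s^-1%g j); rewrite ?permKV // inE /= /excedance permKV.
Qed.

Lemma exc_equivP s u :
  reflect ((forall i, (i < s i) = (i < u i)) /\
           (forall j, (s^-1%g j < j) = (u^-1%g j < j)))
          (exc_equiv s u).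
Proof.
apply: (iffP andP) => [[/eqP eP /eqP eL]|[eP eL]].
  by split=> i; rewrite -?mem_Excp -?mem_Excl ?eP ?eL.
by split; apply/eqP/setP=> i; rewrite ?mem_Excp ?mem_Excl.
Qed.

Lemma exc_equiv_refl s : exc_equiv s s.
Proof. by rewrite /exc_equiv !eqxx. Qed.

Lemma exc_equiv_sym s u : exc_equiv s u = exc_equiv u s.
Proof. by rewrite /exc_equiv [Excp s == _]eq_sym [Excl s == _]eq_sym. Qed.

Lemma exc_equiv_trans s u w : exc_equiv s u -> exc_equiv u w -> exc_equiv s w.
Proof. by rewrite /exc_equiv => /andP[/eqP-> /eqP->]. Qed.

Lemma prefix_equivP (m : nat) s u :
  reflect (exc_equiv s u /\
           forall i, i < m -> (s i < m) || (u i < m) -> s i = u i)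
          (prefix_equiv m s u).
Proof.
apply: (iffP andP) => [[-> /forallP h]|[-> h]]; split=> //.
  by move=> i im su; apply/eqP; move: (h i); rewrite im su.
by apply/forallP=> i; apply/implyP=> im; apply/implyP=> su; apply/eqP/h.
Qed.

Lemma prefix_equiv_refl m s : prefix_equiv m s s.
Proof. by apply/prefix_equivP; rewrite exc_equiv_refl. Qed.

Lemma prefix_equiv_sym m s u : prefix_equiv m s u -> prefix_equiv m u s.
Proof.
case/prefix_equivP=> e h; apply/prefix_equivP; rewrite exc_equiv_sym e.
by split=> // i im; rewrite orbC => /h ->.
Qed.

Lemma prefix_equiv_trans m s u w :
  prefix_equiv m s u -> prefix_equiv m u w -> prefix_equiv m s w.
Proof.
move=> /prefix_equivP[e1 h1] /prefix_equivP[e2 h2]; apply/prefix_equivP.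
split=> [|i im]; first exact: exc_equiv_trans e2.
by case/orP=> lt; [have e := h1 i im | have e := h2 i im];
  rewrite lt ?orbT in e; have {}e := e isT;
  [rewrite e -h2 // -e lt | rewrite -e h1 // e lt orbT].
Qed.

Lemma prefix_equiv_lt m s u i :
  prefix_equiv m s u -> i < m -> (s i < m) = (u i < m).
Proof.
case/prefix_equivP=> _ h im.
by apply/idP/idP => lt; have := h i im; rewrite lt ?orbT => /(_ isT);
   [move=> <- | move=> ->].
Qed.

Lemma prefix_equiv_ge m s u i :
  prefix_equiv m s u -> i < m -> (m <= s i) = (m <= u i).
Proof. by move=> su im; rewrite !(leqNgt m) (prefix_equiv_lt su). Qed.

Lemma prefix_equiv_inv_lt m s u j :
  prefix_equiv m s u -> j < m -> s^-1%g j < m -> u^-1%g j = s^-1%g j.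
Proof.
case/prefix_equivP=> _ h jm im.
by apply: (@perm_inj _ u); rewrite permKV -h ?permKV ?jm.
Qed.

(** * Open paths and their number *)

Lemma eq_open_ends m s u :
  prefix_equiv m s u -> open_ends m s = open_ends m u.
Proof.
move=> su; apply/setP=> i; rewrite !inE; case: ltnP => //= im.
exact: prefix_equiv_ge su im.
Qed.

Lemma eq_open_begs m s u :
  prefix_equiv m s u -> open_begs m s = open_begs m u.
Proof.
move=> su; apply/setP=> j; rewrite !inE; case: ltnP => //= jm.
have us := prefix_equiv_sym su.
rewrite !(leqNgt m); congr (~~ _); apply/idP/idP => lt.
  by rewrite (prefix_equiv_inv_lt su).
by rewrite (prefix_equiv_inv_lt us).
Qed.

Lemma mem_perm_imset s (S : {set 'I_n}) j : (j \in s @: S) = (s^-1%g j \in S).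
Proof. by rewrite -{1}[j](permKV s) mem_imset //; apply: perm_inj. Qed.

Lemma card_open_begs m s : #|open_begs m s| = #|open_ends m s|.
Proof.
pose L := [set i : 'I_n | i < m].
have e1 : open_ends m s = L :\: s @^-1: L.
  by apply/setP=> i; rewrite !inE -leqNgt andbC.
have e2 : open_begs m s = L :\: s @: L.
  by apply/setP=> j; rewrite 2!inE mem_perm_imset !inE -leqNgt andbC.
rewrite e1 e2 !cardsD; congr (_ - _).
have -> : L :&: s @: L = s @: (L :&: s @^-1: L).
  by apply/setP=> j; rewrite mem_perm_imset 3!inE mem_perm_imset !inE permKV andbC.
by rewrite card_imset //; apply: perm_inj.
Qed.

(** An open end is an excedance position below [m] with image at least [m]. The excedance positions
    with image below [m] correspond under [s] to the excedance values below [m]. *)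
Lemma card_open_ends m s :
  #|open_ends m s| =
  #|[set i : 'I_n in Excp s | i < m]| - #|[set j : 'I_n in Excl s | j < m]|.
Proof.
have <- : s @: [set i : 'I_n in Excp s | s i < m] = [set j : 'I_n in Excl s | j < m].
  by apply/setP=> j; rewrite mem_perm_imset !inE mem_Excl /excedance permKV.
rewrite card_imset; last exact: perm_inj.
rewrite -(cardsID [set i : 'I_n | s i < m] [set i : 'I_n in Excp s | i < m]).
have -> : [set i : 'I_n in Excp s | i < m] :&: [set i : 'I_n | s i < m]
        = [set i : 'I_n in Excp s | s i < m].
  apply/setP=> i; rewrite !inE /excedance.
  by apply/andP/andP => [[/andP[]]|[lt sm]]; rewrite ?lt ?(ltn_trans lt sm).
rewrite addKn; apply: eq_card => i.
rewrite !inE /excedance -leqNgt.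
by apply/andP/and3P => [[im ms]|[-> _ ->]]; rewrite ?im ?(leq_trans im ms).
Qed.

Lemma exc_equiv_card_open_ends m s u :
  exc_equiv s u -> #|open_ends m s| = #|open_ends m u|.
Proof. by case/andP=> /eqP eP /eqP eL; rewrite !card_open_ends eP eL. Qed.

(** * Antirecords, and record-antirecords as a function of the excedance data *)

(** If [i] were an excedance, it would be an open end at [i.+1], so there would be an open beginning
    too: a value at most [i] taken after [i], hence smaller than [s i]. *)
Lemma antirecord_le s i : antirecord s i -> s i <= i.
Proof.
move=> /forallP h; rewrite leqNgt; apply/negP => lt.
have : 0 < #|open_begs i.+1 s|.
  by rewrite card_open_begs; apply/card_gt0P; exists i; rewrite inE ltnS leqnn.
case/card_gt0P=> j; rewrite inE ltnS => /andP[ji ij].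
by have := h (s^-1%g j); rewrite ij permKV /= ltnNge (leq_trans ji (ltnW lt)).
Qed.

Lemma Rar_exc_equiv s u : exc_equiv s u -> Rar s = Rar u.
Proof.
move=> su; apply/setP=> i; rewrite !inE.
(* Without open ends at [i], [w] preserves the indices below [i] and hence those from [i] on;
   together with [w i <= i] this forces [w i = i]. *)
have RarE w : record_antirecord w i = ~~ (i < w i) && (#|open_ends i w| == 0).
  apply/andP/andP => [[/forallP r a]|[]].
    have le := antirecord_le a; split; first by rewrite -leqNgt.
    rewrite cards_eq0; apply/eqP/setP=> j; rewrite !inE.
    apply/negbTE/negP => /andP[ji]; apply/negP; rewrite -ltnNge.
    by move: (r j); rewrite ji => /leq_trans; apply.
  rewrite -leqNgt => le card0.
  have lts (j : 'I_n) : j < i -> w j < i.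
    move=> ji; rewrite ltnNge; apply: contraL card0 => ij.
    by rewrite -lt0n; apply/card_gt0P; exists j; rewrite inE ji.
  have ges (j : 'I_n) : i <= j -> i <= w j.
    move=> ij; rewrite leqNgt; apply: contraL card0 => wji.
    rewrite -card_open_begs -lt0n; apply/card_gt0P; exists (w j).
    by rewrite inE wji permK.
  have wi : w i = i by apply/val_inj/eqP; rewrite eqn_leq le ges.
  split; apply/forallP=> j; apply/implyP=> ij; rewrite wi; first exact: lts.
  rewrite ltn_neqAle ges ?(ltnW ij) // andbT -{1}wi.
  by rewrite (inj_eq val_inj) (inj_eq perm_inj) -(inj_eq val_inj) neq_ltn ij.
by rewrite !RarE (exc_equiv_card_open_ends i su); case/exc_equivP: su => ->.
Qed.

(** * Following open paths, and the choice made at an index *)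

(** Ends of paths are fixed, so that iteration stays at an end once it is reached. *)
Definition path_step m s x := if s x < m then s x else x.

(* The exponent of 'S_n divides its order, so this many steps suffice to reach
   the end of any open path. *)
Definition path_end m s x := iter #|[set: 'S_n]| (path_step m s) x.

(** These are the values at most [t] with preimage at least [t]; [t] is one of them exactly when it
    is not an excedance value. *)
Definition available t s :=
  if t \in Excl s then open_begs t s else t |: open_begs t s.

Definition choices t s :=
  setX (if t \in Excl s then open_ends t s else [set t])
       (if t \in Excp s then [set t] else available t s).

(* The value t encodes the absence of a choice: the preimage or the image of t
   is then at least t, so it is not visible among the indices up to t, apart
   from a fixed point t. *)
Definition choice t s : 'I_n * 'I_n :=
  (if s^-1%g t < t then s^-1%g t else t, if s t < t then s t else t).

(** The preimage of [t] for which the image [q] closes a cycle. When [t] is not an excedance value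
    its preimage is coded by [t], and closing means that [t] is fixed. *)
Definition closing_end t s q := if t \in Excl s then path_end t s q else q.

Lemma exc_equiv_Excp s u i : exc_equiv s u -> (i \in Excp s) = (i \in Excp u).
Proof. by case/andP=> /eqP->. Qed.

Lemma exc_equiv_Excl s u i : exc_equiv s u -> (i \in Excl s) = (i \in Excl u).
Proof. by case/andP=> _ /eqP->. Qed.

Lemma prefix_equiv_exc m s u : prefix_equiv m s u -> exc_equiv s u.
Proof. by case/prefix_equivP. Qed.

Lemma eq_available t s u :
  prefix_equiv t s u -> available t s = available t u.
Proof.
move=> su; rewrite /available (exc_equiv_Excl _ (prefix_equiv_exc su)).
by rewrite (eq_open_begs su).
Qed.

Lemma eq_choices t s u : prefix_equiv t s u -> choices t s = choices t u.
Proof.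
move=> su; have e := prefix_equiv_exc su.
by rewrite /choices (exc_equiv_Excl _ e) (exc_equiv_Excp _ e) (eq_available su)
  (eq_open_ends su).
Qed.

Lemma not_Excp t s : t \notin Excp s -> s t = (choice t s).2.
Proof.
rewrite mem_Excp -leqNgt leq_eqVlt /choice /=.
by case: ltnP => //= _; rewrite orbF => /eqP/val_inj.
Qed.

Lemma in_Excl t s : t \in Excl s -> s^-1%g t = (choice t s).1.
Proof. by rewrite mem_Excl /choice /= => ->. Qed.

Lemma notin_available t s j :
  j <= t -> t <= s^-1%g j -> j \in available t s.
Proof.
move=> jt tj; rewrite /available; case: ifP => tE.
  rewrite inE tj andbT ltn_neqAle jt andbT; apply/negP => /eqP/val_inj ej.
  by move: tE tj; rewrite mem_Excl ltnNge ej => /negPf->.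
rewrite !inE tj andbT; move: jt; rewrite leq_eqVlt.
by case/orP=> [/eqP/val_inj->|->]; rewrite ?eqxx ?orbT.
Qed.

Lemma availableP t s j :
  reflect (j <= t /\ t <= s^-1%g j) (j \in available t s).
Proof.
apply: (iffP idP) => [|[]]; last exact: notin_available.
rewrite /available; case: ifP => tE; last rewrite !inE.
  by rewrite inE => /andP[/ltnW].
case/orP=> [/eqP->|/andP[/ltnW //]].
by rewrite leqnn leqNgt -mem_Excl tE.
Qed.

Lemma choice_in t s : choice t s \in choices t s.
Proof.
rewrite /choices inE; apply/andP; split.
  case: ifP => tE; last by rewrite inE /choice /= -mem_Excl tE.
  by rewrite -in_Excl // inE -mem_Excl tE permKV leqnn.
case: ifPn => tP; first by rewrite inE /choice /= ltnNge ltnW -?mem_Excp.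
rewrite -not_Excp //; apply/availableP; rewrite permK leqnn.
by rewrite leqNgt -mem_Excp.
Qed.

(** The pairs newly revealed have [t] as an entry and the other entry at most [t]; these are what
    [choice] records. *)
Lemma prefix_equivS t s u :
  prefix_equiv t.+1 s u = prefix_equiv t s u && (choice t s == choice t u).
Proof.
apply/idP/andP => [su|[su /eqP ec]].
  have e := prefix_equiv_exc su; have [eP eL] := exc_equivP _ _ e.
  have [_ h] := prefix_equivP _ _ _ su; split.
    apply/prefix_equivP; split=> // i it lt; apply: h; first by rewrite ltnS ltnW.
    by rewrite !ltnS; case/orP: lt => /ltnW->; rewrite ?orbT.
  rewrite /choice eL; apply/eqP; congr (_, _).
    case: ifP => // lt; apply: (@perm_inj _ u); rewrite permKV -h ?permKV //.
      by rewrite ltnS ltnW // eL.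
    by rewrite ltnS leqnn.
  have {}h : (s t < t) || (u t < t) -> s t = u t.
    move=> lt; apply: h; first by rewrite ltnS.
    by rewrite !ltnS; case/orP: lt => /ltnW->; rewrite ?orbT.
  case: (boolP (_ || _)) h => [lt /(_ isT) <- //|].
  by rewrite negb_or => /andP[/negPf-> /negPf->].
have [e h] := prefix_equivP _ _ _ su.
have [eP eL] := exc_equivP _ _ e.
apply/prefix_equivP; split=> // i; rewrite !ltnS leq_eqVlt.
case/orP=> [/eqP/val_inj -> lt|it lt].
  have nP : t \notin Excp s.
    by rewrite mem_Excp -leqNgt; case/orP: lt => //; rewrite leqNgt -eP -leqNgt.
  by rewrite (not_Excp nP) ec -not_Excp // -(exc_equiv_Excp _ e).
have [lt'|] := boolP ((s i < t) || (u i < t)); first exact: h.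
rewrite negb_or -!leqNgt => /andP[les leu].
(* Here [i] is below [t] and neither image is, so a revealed image equals [t]: [i] is then the
   preimage recorded by the common choice. *)
have key (w v : 'S_n) : exc_equiv w v -> choice t w = choice t v ->
    w i <= t -> t <= w i -> w i = v i.
  move=> e' c' wle wge; have wi : w i = t by apply/val_inj/eqP; rewrite eqn_leq wle.
  have tE : t \in Excl w by rewrite mem_Excl -wi permK wi.
  have := in_Excl tE; rewrite c' -in_Excl -?(exc_equiv_Excl _ e') //.
  by move=> ei; rewrite wi -[i](permK w) wi ei permKV.
case/orP: lt => lt; first exact: key.
by apply/esym/(key u s); rewrite // exc_equiv_sym.
Qed.

(** * Every choice is realised, by swaps that keep the prefix *)

(** Both images are at least [m], hence above both [p] and [q]; exchanging them leaves both
    positions and both values excedant. *)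
Lemma swap_open_ends m s p q :
  p \in open_ends m s -> q \in open_ends m s ->
  prefix_equiv m s (tperm p q * s)%g.
Proof.
rewrite !inE => /andP[pm mp] /andP[qm mq].
have ltp : p < s p by apply: leq_trans mp.
have ltpq : p < s q by apply: leq_trans mq.
have ltq : q < s q by apply: leq_trans mq.
have ltqp : q < s p by apply: leq_trans mp.
apply/prefix_equivP; split; last first.
  by move=> i im; rewrite permM; case: tpermP => // ->; rewrite !ltnNge mp mq.
apply/exc_equivP; split=> i.
  by rewrite permM; case: tpermP => // ->; rewrite ?ltp ?ltq ?ltpq ?ltqp.
rewrite invMg permM tpermV -{2 4}[i](permKV s).
by case: tpermP => // ->; rewrite ?ltp ?ltq ?ltpq ?ltqp.
Qed.

(** Both values are at most [t] and taken at positions at least [t]; exchanging them creates no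
    excedance and touches no position below [t]. *)
Lemma swap_available t s p q :
  p \in available t s -> q \in available t s ->
  prefix_equiv t s (s * tperm p q)%g.
Proof.
move=> /availableP[pt tp] /availableP[qt tq].
have ge i : (s i == p) || (s i == q) -> t <= i.
  by case/orP=> /eqP e; rewrite -[i](permK s) e.
apply/prefix_equivP; split; last first.
  move=> i it _; rewrite permM tpermD // eq_sym; apply/negP=> e;
    by move: (ge i); rewrite e ?orbT => /(_ isT); rewrite leqNgt it.
apply/exc_equivP; split=> i.
  rewrite permM; case: tpermP => // e; rewrite ?e; have := ge i;
    rewrite e eqxx ?orbT => /(_ isT) ti;
    by rewrite !ltnNge !(leq_trans _ ti).
rewrite invMg permM tpermV; case: tpermP => // ->;
  by rewrite !ltnNge !(leq_trans pt, leq_trans qt).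
Qed.

(** First the preimage of [t] is corrected by a swap of open ends, then its image by a swap of
    available values. *)
Lemma choice_exists t s c :
  c \in choices t s -> exists2 u, prefix_equiv t s u & choice t u = c.
Proof.
case: c => p q; rewrite inE /= => /andP[pin qin].
have [u su up] : exists2 u, prefix_equiv t s u & (choice t u).1 = p.
  move: pin; case: ifP => tE; last first.
    rewrite inE => /eqP->; exists s; first exact: prefix_equiv_refl.
    by rewrite /choice /= -mem_Excl tE.
  have := choice_in t s; rewrite inE tE => /andP[p0in _] pin.
  exists (tperm p (choice t s).1 * s)%g; first exact: swap_open_ends.
  rewrite /choice invMg permM tpermV -/(choice t s) in_Excl // tpermR.
  by move: pin; rewrite inE => /andP[->].
move: qin; have e := prefix_equiv_exc su.
rewrite (exc_equiv_Excp _ e) (eq_available su); case: ifPn => tP.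
  rewrite inE => /eqP->; exists u => //.
  rewrite -up; apply/eqP; rewrite xpair_eqE eqxx /=.
  by rewrite ltnNge ltnW -?mem_Excp.
have := choice_in t u; rewrite inE (negPf tP) => /andP[_ q0in] qin.
have uw := swap_available q0in qin; exists (u * tperm (choice t u).2 q)%g.
  exact: prefix_equiv_trans uw.
set w := (u * _)%g in uw *.
have eW := prefix_equiv_exc uw.
have tPw : t \notin Excp w by rewrite -(exc_equiv_Excp _ eW).
rewrite [choice t w]surjective_pairing -(not_Excp tPw) permM (not_Excp tP) tpermL.
congr (_, _); rewrite -up; have [tE|tE] := boolP (t \in Excl u).
  rewrite -in_Excl -?(exc_equiv_Excl _ eW) // -in_Excl // invMg permM tpermV.
  rewrite tpermD //.
    by apply: contraTneq q0in => ->; rewrite /available tE inE ltnn.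
  by apply: contraTneq qin => ->; rewrite /available tE inE ltnn.
have tEw := tE; rewrite (exc_equiv_Excl _ eW) in tEw.
by rewrite /choice /= -!mem_Excl (negPf tE) (negPf tEw).
Qed.

(** * Antirecords and cycle maxima read off the choice *)

(** Values above [t] exceed [s t] as soon as [s t <= t], so only the available ones need comparing
    with it. *)
Lemma mem_Arecp t s :
  (t \in Arecp s) =
  (t \notin Excp s) && [forall q in available t s, (choice t s).2 <= q].
Proof.
rewrite inE; apply/idP/andP => [a|[tP /forallP h]].
  have tP : t \notin Excp s by rewrite mem_Excp -leqNgt antirecord_le.
  split=> //; rewrite -not_Excp //; apply/forallP => q; apply/implyP.
  case/availableP=> _; rewrite leq_eqVlt => /orP[/eqP/val_inj ->|lt].
    by rewrite permKV.
  by move/forallP: a => /(_ (s^-1%g q)); rewrite lt permKV => /ltnW.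
apply/forallP=> i; apply/implyP=> ti.
have st : s t <= t by rewrite leqNgt -mem_Excp.
rewrite ltn_neqAle (inj_eq val_inj) (inj_eq perm_inj) -(inj_eq val_inj).
rewrite (ltn_eqF ti) /= {1}not_Excp //.
have [le|lt] := leqP (s i) t; last by rewrite -not_Excp // (leq_trans st) // ltnW.
move: (h (s i)) => /implyP; apply; apply/availableP; split=> //.
by rewrite permK ltnW.
Qed.

Lemma mem_Cyc_porbit s i : (i \in Cyc s) = [forall j in porbit s i, j <= i].
Proof.
rewrite inE; apply/existsP/idP => [[C /and3P[/imsetP[x _ ->]]]|h].
  by rewrite -eq_porbit_mem => /eqP ->.
by exists (porbit s i); rewrite imset_f // porbit_id.
Qed.

Lemma path_iter_lt m s x k : x < m -> iter k (path_step m s) x < m.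
Proof. by move=> xm; elim: k => //= k IHk; rewrite {1}/path_step; case: ifP. Qed.

Lemma path_iter_stop m s x k : m <= s x -> iter k (path_step m s) x = x.
Proof.
by move=> mx; elim: k => //= k ->; rewrite /path_step ltnNge mx.
Qed.

Lemma path_iter_perm m s x k :
  s (iter k (path_step m s) x) < m -> iter k (path_step m s) x = (s ^+ k)%g x.
Proof.
elim: k => [|k IHk]; first by rewrite expg0 perm1.
rewrite iterS expgSr permM {1 3}/path_step; case: ifP => lt; last by rewrite lt.
by rewrite IHk.
Qed.

Lemma porbit_image s x : porbit s (s x) = porbit s x.
Proof. by rewrite -[RHS](porbit_perm s 1) expg1. Qed.

Lemma path_iter_porbit m s x k : iter k (path_step m s) x \in porbit s x.
Proof.
elim: k => [|k IHk]; first exact: porbit_id.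
rewrite iterS {1}/path_step; case: ifP => // _.
by rewrite -eq_porbit_mem porbit_image eq_porbit_mem.
Qed.

Lemma path_end_open m s q :
  q \in open_begs m s -> path_end m s q \in open_ends m s.
Proof.
rewrite !inE => /andP[qm mq]; rewrite path_iter_lt //= leqNgt.
(* Had the iteration not stopped, it would follow [s] and return to [q] after as many steps as the
   order of the group, which would give [q] a preimage below [m]. *)
apply/negP; rewrite /path_end.
have := expg_cardG (in_setT s); have : 0 < #|[set: 'S_n]| by apply: cardG_gt0.
case: #|_| => // N _ sN.
rewrite iterS {1}/path_step; case: ifP => [lt _|-> //].
have := path_iter_perm lt; move/(congr1 s).
rewrite -permM -expgSr sN perm1 => sq.
by move: mq; rewrite -sq permK leqNgt path_iter_lt.
Qed.

Lemma eq_path_end m s u q :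
  prefix_equiv m s u -> q < m -> path_end m s q = path_end m u q.
Proof.
move=> su qm; rewrite /path_end; elim: #|_| => //= k <-.
have km := path_iter_lt s k qm; rewrite /path_step -(prefix_equiv_lt su km).
by case: ifP => // lt; case/prefix_equivP: su => _ -> //; rewrite lt.
Qed.

Lemma porbit_fix s i : s i = i -> porbit s i = [set i].
Proof.
move=> si; apply/setP=> j; rewrite inE; apply/porbitP/eqP => [[k ->]|->].
  exact: permX_fix.
by exists 0; rewrite expg0 perm1.
Qed.

Lemma path_end_closing t s :
  t \in Excl s -> t \notin Excp s -> s (path_end t s (s t)) = t -> t \in Cyc s.
Proof.
move=> tE tP sz; rewrite mem_Cyc_porbit; apply/forallP=> j; apply/implyP.
have qt : s t < t.
  rewrite ltn_neqAle leqNgt -mem_Excp tP andbT; apply: contraTneq tE.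
  by rewrite mem_Excl => /val_inj st; rewrite -{1}st permK ltnn.
(* [Z] contains [t] and is stable under [s], so it contains the whole cycle; its other elements lie
   below [t]. *)
pose Z x := x = t \/ exists k, x = iter k (path_step t s) (s t).
have Zs x : Z x -> Z (s x).
  case=> [->|[k ->]]; first by right; exists 0.
  set x' := iter k _ _; have [lt|ge] := ltnP (s x') t.
    by right; exists k.+1; rewrite iterS -/x' /path_step lt.
  (* The iteration has stopped at [x'], which is therefore the end of the path, and the hypothesis
     sends that end to [t]. *)
  left; rewrite -[RHS]sz; congr (s _).
  rewrite -(path_iter_stop #|[set: 'S_n]| ge) /x' -iterD addnC iterD.
  by apply: path_iter_stop; rewrite -/(path_end t s (s t)) sz.
case/porbitP=> k ->; have [->|[l ->]] : Z ((s ^+ k)%g t) => //.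
  elim: k => [|k IHk]; first by left; rewrite expg0 perm1.
  by rewrite expgSr permM; apply: Zs.
by rewrite ltnW // path_iter_lt.
Qed.

(** When [t] is a cycle maximum and an excedance value, the path from [s t] ends at a point whose
    image is at least [t], and at most [t] because it lies on the cycle of [t]. *)
Lemma mem_Cyc t s :
  (t \in Cyc s) =
  (t \notin Excp s) && ((choice t s).1 == closing_end t s (choice t s).2).
Proof.
have orb x : t \in Cyc s -> x \in porbit s t -> x <= t.
  by rewrite mem_Cyc_porbit => /forallP/(_ x)/implyP.
case: (boolP (t \in Excp s)) => tP; rewrite [~~ _]/= ?andFb ?andTb.
  apply/negP=> /orb/(_ (mem_porbit s 1 t)).
  by rewrite expg1 leqNgt -mem_Excp tP.
rewrite -not_Excp // /closing_end; case: (boolP (t \in Excl s)) => tE.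
  rewrite -in_Excl //; apply/idP/eqP => [tC|ez].
    apply: (@perm_inj _ s); rewrite permKV; apply/val_inj/eqP.
    have : s t \in open_begs t s.
      have := choice_in t s; rewrite inE (negPf tP) /available tE => /andP[_].
      by rewrite -not_Excp.
    move/path_end_open; rewrite inE eqn_leq => /andP[_ -> /=].
    apply: orb => //; rewrite -eq_porbit_mem porbit_image.
    rewrite -[X in _ == X](porbit_image s) eq_porbit_mem; exact: path_iter_porbit.
  by apply: path_end_closing => //; rewrite -ez permKV.
have -> : (choice t s).1 = t by rewrite /choice /= -mem_Excl (negPf tE).
apply/idP/eqP => [tC|/esym st].
  apply/(@perm_inj _ s^-1); rewrite permK; apply/val_inj/eqP; rewrite eqn_leq.
  have -> : s^-1%g t <= t.
    apply: orb => //; rewrite -eq_porbit_mem.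
    by rewrite -[X in X == _](porbit_image s) permKV.
  by rewrite leqNgt -mem_Excl.
by rewrite mem_Cyc_porbit porbit_fix //; apply/forallP=> j; rewrite inE;
  apply/implyP=> /eqP->.
Qed.

Lemma eq_closing_end t s u q :
  prefix_equiv t s u -> q \in available t s ->
  closing_end t s q = closing_end t u q.
Proof.
move=> su; rewrite /closing_end /available.
rewrite -(exc_equiv_Excl _ (prefix_equiv_exc su)); case: ifP => // _.
by rewrite inE => /andP[qt _]; apply: eq_path_end.
Qed.

(** * The number of choices with prescribed answers *)

Definition choices_with t s a b :=
  [set c in choices t s |
     ((t \notin Excp s) && (c.1 == closing_end t s c.2) == a) &&
     ((t \notin Excp s) && [forall q in available t s, c.2 <= q] == b)].

(** Both tests involve only the revealed prefix and the excedance data, so those for [u] can be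
    evaluated in [s]. *)
Lemma choice_in_with t s u a b : prefix_equiv t s u ->
  (choice t u \in choices_with t s a b) =
  ((t \in Cyc u) == a) && ((t \in Arecp u) == b).
Proof.
move=> su; have cin := choice_in t u.
rewrite inE mem_Cyc mem_Arecp (eq_choices su) cin /=.
rewrite -(exc_equiv_Excp _ (prefix_equiv_exc su)) (eq_available su).
case: (boolP (t \in Excp s)) => //= tP; congr ((_ == _ == _) && _).
apply: (eq_closing_end su); rewrite (eq_available su); move: cin.
rewrite inE -(exc_equiv_Excp _ (prefix_equiv_exc su)) (negPf tP).
by case/andP.
Qed.

Lemma card_available t s :
  #|available t s| = (t \notin Excl s) + #|open_ends t s|.
Proof.
rewrite /available; case: ifP => _; first by rewrite card_open_begs.
by rewrite cardsU1 inE ltnn /= card_open_begs.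
Qed.

Lemma available_min t s :
  t \notin Excp s ->
  exists2 m, m \in available t s &
    {in available t s, forall q, [forall r in available t s, q <= r] = (q == m)}.
Proof.
move=> tP.
have in0 : s t \in available t s.
  by apply/availableP; rewrite permK leqnn leqNgt -mem_Excp.
case: (@arg_minnP _ (s t) [in available t s] val in0) => m min le.
exists m => // q qin; apply/forallP/eqP => [/(_ m)|-> r].
  by rewrite min /= => qm; apply/val_inj/eqP; rewrite eqn_leq qm le.
by apply/implyP/le.
Qed.

Lemma closing_end_open t s q :
  t \in Excl s -> q \in available t s -> closing_end t s q \in open_ends t s.
Proof.
by move=> tE; rewrite /closing_end /available tE; apply: path_end_open.
Qed.

(* For t in Excl s but not in Excp s, the k open paths give k choices of
   preimage and k of image, and any image is closed by exactly one preimage: the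
   two events are independent, each with one favourable case out of k.  For t in
   neither, the two events are the choices of t itself and of the least
   available value, which coincide iff no other value is available. *)
Lemma card_choices_with t s u a b :
  exc_equiv s u -> #|choices_with t s a b| = #|choices_with t u b a|.
Proof.
move=> su; have eE := exc_equiv_card_open_ends t su.
have eA : #|available t s| = #|available t u|.
  by rewrite !card_available (exc_equiv_Excl _ su) eE.
have ePt := exc_equiv_Excp t su; have eLt := exc_equiv_Excl t su.
(* An excedance is neither a cycle maximum nor an antirecord, so both answers must be negative. *)
case: (boolP (t \in Excp s)) => tP.
  have tPu : t \in Excp u by rewrite -ePt.
  have countE w c d : t \in Excp w ->
      choices_with t w c d = if c || d then set0 else choices t w.
    move=> wP; apply/setP=> z; rewrite inE wP.
    by case: c d => -[]; rewrite ?inE ?andbF ?andbT.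
  rewrite !countE // orbC; case: ifP => // _.
  by rewrite /choices -ePt -eLt tP !cardsX; case: ifP; rewrite ?eE.
have tPu : t \notin Excp u by rewrite -ePt.
have [m min hm] := available_min tP; have [m' min' hm'] := available_min tPu.
have [tE|tE] := boolP (t \in Excl s).
  have tEu : t \in Excl u by rewrite -eLt.
  have countE w r c d : t \notin Excp w -> t \in Excl w -> r \in available t w ->
      {in available t w, forall q, [forall v in available t w, q <= v] = (q == r)} ->
      #|choices_with t w c d| =
      (if c then 1 else #|open_ends t w|.-1) * (if d then 1 else #|available t w|.-1).
    move=> wP wE rin hr.
    rewrite -(card_pairs_graph_point c d (fun q => @closing_end_open t w q wE) rin).
    apply: eq_card => -[p q].
    rewrite [LHS]inE [RHS]inE /choices (negPf wP) wE !in_setX /=.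
    by case: (boolP (q \in available t w)) => qin; rewrite ?andbF //= hr.
  rewrite (countE s m) // (countE u m') // -eE -eA card_available tE add0n.
  by rewrite mulnC.
have tEu : t \notin Excl u by rewrite -eLt.
have countE w r c d : t \notin Excp w -> t \notin Excl w -> r \in available t w ->
    {in available t w, forall q, [forall v in available t w, q <= v] = (q == r)} ->
    #|choices_with t w c d| =
    #|[set q in available t w | ((q == t) == c) && ((q == r) == d)]|.
  move=> wP wE rin hr; rewrite -(card_imset _ (fun x y (e : (t, x) = (t, y)) => congr1 snd e)).
  apply: eq_card => -[p q].
  rewrite [LHS]inE /choices /closing_end (negPf wP) (negPf wE) in_setX in_set1 /=.
  apply/idP/imsetP => [|[q' + [-> ->]]].
    case/and3P=> /andP[/eqP-> qin] h1 h2; exists q => //.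
    by rewrite inE qin [_ == t]eq_sym h1 -hr.
  by rewrite inE eqxx [_ == t]eq_sym => /and3P[qin -> /=]; rewrite hr // qin.
have tin w : t \notin Excl w -> t \in available t w.
  by move=> wE; apply/availableP; rewrite leqnn leqNgt -mem_Excl.
have eqt w r : t \notin Excl w -> r \in available t w ->
    {in available t w, forall q, [forall v in available t w, q <= v] = (q == r)} ->
    (t == r) = (#|available t w| == 1).
  move=> wE rin hr; apply/idP/cards1P => [|[x ex]].
    rewrite -hr ?tin // => /forallP h; exists t; apply/setP=> q; rewrite inE.
    apply/idP/eqP => [qin|->]; last exact: tin.
    apply/val_inj/eqP; rewrite eqn_leq; have := h q; rewrite qin /= => ->.
    by case/availableP: qin => ->.
  by move: (tin w wE) rin; rewrite ex !inE => /eqP-> /eqP->.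
rewrite (countE s m) // (countE u m') // !card_two_points ?tin //.
rewrite (eqt s m) // (eqt u m') // -eA eq_sym.
by case: eqP => // ->.
Qed.

(** * Counting completions by downward induction *)

Implicit Types A B : {set 'I_n}.

Definition completions k s A B :=
  [set u | prefix_equiv k s u &&
    [forall i : 'I_n, (k <= i) ==>
       ((i \in Cyc u) == (i \in A)) && ((i \in Arecp u) == (i \in B))]].

Lemma completions_last s A B : completions n s A B = [set s].
Proof.
apply/setP=> u; rewrite !inE; apply/andP/eqP => [[/prefix_equivP[_ su] _]|->].
  by apply/permP=> i; rewrite su ?ltn_ord.
rewrite prefix_equiv_refl; split=> //; apply/forallP=> i.
by rewrite leqNgt ltn_ord.
Qed.

(** Sort the completions by their choice at [t]. Each admissible choice is realised by some [v], and
    its class consists of the completions of [v] from [t.+1]. *)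
Lemma card_completions_step t s A B N :
    (forall v, exc_equiv s v -> #|completions t.+1 v A B| = N) ->
  #|completions t s A B| = #|choices_with t s (t \in A) (t \in B)| * N.
Proof.
move=> hN; rewrite -sum1_card.
have completionP u : u \in completions t s A B ->
    prefix_equiv t s u /\ choice t u \in choices_with t s (t \in A) (t \in B).
  by rewrite inE => /andP[su /forallP/(_ t)]; rewrite leqnn /= choice_in_with.
rewrite (partition_big (choice t) [in choices_with t s (t \in A) (t \in B)]) /=;
  last by move=> u /completionP[].
rewrite -sum_nat_const; apply: eq_bigr => c cin.
have [v sv ec] : exists2 v, prefix_equiv t s v & choice t v = c.
  by apply: choice_exists; move: cin; rewrite inE => /andP[].
rewrite -(hN v (prefix_equiv_exc sv)) sum1dep_card; apply: eq_card => u.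
rewrite [LHS]inE; apply/andP/idP => [[uin /eqP eu]|].
  have [su _] := completionP u uin; move: uin; rewrite !inE => /andP[_ /forallP h].
  rewrite prefix_equivS ec eu eqxx andbT.
  rewrite (prefix_equiv_trans (prefix_equiv_sym sv) su) /=.
  apply/forallP=> i; apply/implyP=> ti; have := h i.
  by rewrite ltnW.
rewrite inE prefix_equivS ec => /andP[/andP[vu /eqP cu] /forallP h].
have su := prefix_equiv_trans sv vu; split; last by rewrite -cu.
rewrite inE su; apply/forallP=> i; apply/implyP; rewrite leq_eqVlt.
case/orP=> [/eqP/val_inj <-|ti]; last by have := h i; rewrite ti.
by rewrite -(choice_in_with _ _ su) -cu.
Qed.

(** Two permutations [s] and [u] are compared because different choices lead to different prefixes:
    the induction must also show that the count depends only on the excedance data. *)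
Lemma card_completions_sym k s u A B : k <= n ->
  exc_equiv s u -> #|completions k s A B| = #|completions k u B A|.
Proof.
move/subnKC; move: (n - k) => d; elim: d k s u A B => [|d IHd] k s u A B.
  by rewrite addn0 => -> _; rewrite !completions_last !cards1.
move=> kd su; have kn : k < n by rewrite -kd -addSnnS leq_addr.
have {}IHd v w A' B' : exc_equiv v w ->
    #|completions k.+1 v A' B'| = #|completions k.+1 w B' A'|.
  by apply: IHd; rewrite addSnnS.
rewrite -[k]/(val (Ordinal kn)).
rewrite (@card_completions_step _ s A B #|completions k.+1 s B A|); last first.
  by move=> v sv; apply: IHd; rewrite exc_equiv_sym.
(* The same [N] serves for the order [B], [A]: two uses of the induction hypothesis exchange the
   sets twice. *)
rewrite (@card_completions_step _ u B A #|completions k.+1 s B A|); last first.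
  move=> v uv; rewrite (IHd s s B A) ?exc_equiv_refl //; apply: IHd.
  by rewrite exc_equiv_sym (exc_equiv_trans su).
by congr (_ * _); apply: card_choices_with.
Qed.

Lemma completions0 s A B :
  completions 0 s A B = [set u | [&& exc_equiv s u, Cyc u == A & Arecp u == B]].
Proof.
apply/setP=> u; rewrite !inE; congr (_ && _).
  by apply/prefix_equivP/idP => [[]|].
apply/forallP/andP => [h|[/eqP-> /eqP->] i]; last by rewrite !eqxx.
by split; apply/eqP/setP=> i; case/andP: (h i) => /eqP ? /eqP ?.
Qed.

End Prefix.

(** * Equidistribution as the case of an empty prefix *)

Theorem theorem2 (n : nat) (hn : 1 <= n) (A B D E F : {set 'I_n}) :
  #|[set s : 'S_n |
      (Cyc s, Arecp s, Excp s, Excl s, Rar s) == (A, B, D, E, F)]| =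
  #|[set s : 'S_n |
      (Arecp s, Cyc s, Excp s, Excl s, Rar s) == (A, B, D, E, F)]|.
Proof.
pose X := [set s : 'S_n | [&& Excp s == D, Excl s == E & Rar s == F]].
have [X0|[s0]] := set_0Vmem X.
  have notX s : [&& Excp s == D, Excl s == E & Rar s == F] = false.
    by have := in_set0 s; rewrite -X0 inE.
  by apply: eq_card => s; rewrite [LHS]inE [RHS]inE !quintuple_eqE notX !andbF.
rewrite inE => /and3P[/eqP eD /eqP eE /eqP eF].
(* [Rar] is determined by the excedance data, so the last three conditions describe the class of
   [s0]. *)
have inX s : [&& Excp s == D, Excl s == E & Rar s == F] = exc_equiv s0 s.
  apply/and3P/idP => [[/eqP eDs /eqP eEs _]|e].
    by rewrite /exc_equiv eD eE eDs eEs !eqxx.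
  rewrite -(Rar_exc_equiv e) eF -eD -eE eqxx.
  by case/andP: e => /eqP-> /eqP->; rewrite !eqxx.
transitivity #|completions 0 s0 A B|.
  rewrite completions0; apply: eq_card => s.
  rewrite [LHS]inE [RHS]inE quintuple_eqE inX.
  by case: (Cyc s == A); case: (Arecp s == B); rewrite ?andbF ?andbT.
rewrite (card_completions_sym _ _ (leq0n n) (exc_equiv_refl s0)) completions0.
apply: eq_card => s; rewrite [LHS]inE [RHS]inE quintuple_eqE inX.
by case: (Cyc s == B); case: (Arecp s == A); rewrite ?andbF ?andbT.
Qed.
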